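(* Let $n\ge 2$ and let $A_n$ be the connected anti-regular graph on $n$ vertices. Let $\lambda_0=-1$ if $n$ is even and $\lambda_0=0$ if $n$ is odd. Then the only eigenvalue of (the adjacency matrix of) $A_n$ lying in the closed interval $\Omega=\left[\tfrac{-1-\sqrt{2}}{2},\tfrac{-1+\sqrt{2}}{2}\right]$ is $\lambda_0$.
   Context: A simple graph on $n$ vertices is anti-regular if exactly two of its vertices have the same degree. For each $n\ge 2$ there is, up to isomorphism, exactly one connected anti-regular graph on $n$ vertices, denoted $A_n$. Equivalently, $A_n$ is the threshold graph built from a single vertex by adding vertices one at a time, each new vertex being either isolated (bit $0$) or dominating, i.e. adjacent to all existing vertices (bit $1$), with creation sequence $(0,1,0,1,\dots,0,1)$ if $n$ is even and $(0,0,1,0,1,\dots,0,1)$ if $n$ is odd. Eigenvalues of a graph are those of its adjacency matrix. The number $\lambda_0$ is known to be an eigenvalue of $A_n$. *)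

(* Defs.v *)
From mathcomp Require Import all_boot all_order all_algebra.
From mathcomp Require Import reals.

Set Implicit Arguments.
Unset Strict Implicit.
Unset Printing Implicit Defensive.

Import Order.TTheory GRing.Theory Num.Theory.
Local Open Scope ring_scope.

Definition simple_graph (T : finType) (e : rel T) : Prop :=
  symmetric e /\ irreflexive e.

Definition connected_graph (T : finType) (e : rel T) : Prop :=
  forall x y : T, connect e x y.

Definition degree (T : finType) (e : rel T) (x : T) : nat :=
  #|[set y | e x y]|.

(* "Exactly two vertices have the same degree": there is exactly one unordered
   pair {u, v} of distinct vertices with equal degrees. *)
Definition antiregular (T : finType) (e : rel T) : Prop :=
  exists u v : T,
    [/\ u != v, degree e u = degree e v
      & forall x y : T, x != y -> degree e x = degree e y ->
          [set x; y] = [set u; v]].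

(* The connected anti-regular graph on n >= 2 vertices is unique only up to
   isomorphism; this says that e is a copy of it with vertex set {0, ..., n-1}. *)
Definition is_connected_antiregular (n : nat) (e : rel 'I_n) : Prop :=
  [/\ simple_graph e, connected_graph e & antiregular e].

Definition adjacency_matrix (R : realType) (n : nat) (e : rel 'I_n) : 'M[R]_n :=
  \matrix_(i, j) (e i j)%:R.

Definition lambda0 (R : realType) (n : nat) : R := if odd n then 0 else -1.

Definition Omega (R : realType) : interval R :=
  `[(-1 - Num.sqrt 2) / 2, (-1 + Num.sqrt 2) / 2].

(* Main.v *)
Require Import Defs.
From mathcomp Require Import all_boot all_order all_algebra.
From mathcomp Require Import reals.
From mathcomp Require Import zify lra ring.

(* All degrees 1, ..., n - 1 occur; let v i be a vertex of degree i. By induction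
   on i, the leaf v (i+1) is adjacent exactly to the hubs v (n-1), ..., v (n-i-1),
   and the hub v (n-i-1) to everything but itself and the leaves v 1, ..., v i.
   One vertex w remains, adjacent exactly to the hubs, hence a twin of the last
   leaf (n odd) or of the last hub (n even): this gives the eigenvalue 0, resp.
   -1. Conversely, subtracting consecutive eigenvalue equations, the values Z_i
   of an eigenvector at the leaves satisfy
   mu (2 Z_{i+1} - Z_i - Z_{i+2}) = Z_{i+1} with mu = lambda^2 + lambda, and
   lambda is in Omega iff |mu| <= 1/4, which makes |Z_i| nondecreasing. The
   equation of the last hub then forces Z to vanish unless lambda = lambda0. *)

Import Order.TTheory GRing.Theory Num.Theory.
Local Open Scope ring_scope.

(** * Vertices indexed by degree: leaves and hubs *)

Definition leaves {T : finType} (v : nat -> T) (i : nat) : {set T} :=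
  [set v j.+1 | j : 'I_i].

Definition hubs {T : finType} (v : nat -> T) (i : nat) : {set T} :=
  [set v (#|T| - j.+1)%N | j : 'I_i].

(** Values of [v] outside [0 < i < #|T|] are unconstrained; on this range [v] picks one vertex per
    degree and so misses exactly one vertex. *)
Definition degree_indexed {T : finType} (e : rel T) (v : nat -> T) : Prop :=
  forall i, (0 < i < #|T|)%N -> degree e (v i) = i.

Lemma degree_lt_card (T : finType) (e : rel T) (x : T) :
  irreflexive e -> (degree e x < #|T|)%N.
Proof.
move=> irr_e; rewrite -cardsT; apply/proper_card/properP; split=> //.
by exists x; rewrite !inE ?irr_e.
Qed.

Lemma connected_degree_gt0 (T : finType) (e : rel T) (x : T) :
  (1 < #|T|)%N -> connected_graph e -> (0 < degree e x)%N.
Proof.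
move=> T_gt1 conn_e; have: (0 < #|[set~ x]|)%N by rewrite cardsC1; lia.
case/card_gt0P=> y; rewrite !inE => y_neq_x; apply/card_gt0P.
have /connectP[[|z p] /= pth lst] := conn_e x y; first by rewrite lst eqxx in y_neq_x.
by exists z; rewrite inE; case/andP: pth.
Qed.

(** Without one vertex of the only equal-degree pair, the degree is injective on [#|T| - 1]
    vertices. Its values lie in [1, ..., #|T| - 1], so by counting all of them occur. *)
Lemma degree_indexing (T : finType) (e : rel T) :
  (1 < #|T|)%N -> irreflexive e -> connected_graph e -> antiregular e ->
  exists v, degree_indexed e v.
Proof.
move=> T_gt1 irr_e conn_e [u [w [u_neq_w _ pairP]]].
pose deg x : 'I_#|T| := Ordinal (degree_lt_card T e x irr_e).
pose z : 'I_#|T| := Ordinal (ltnW T_gt1).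
have deg_inj : {in [set~ u] &, injective deg}.
  move=> x y; rewrite !inE => xu yu /(congr1 val) /= deg_xy.
  apply/eqP/negPn/negP => /pairP/(_ deg_xy)/setP/(_ u).
  by rewrite !inE eqxx !(eq_sym u) (negPf xu) (negPf yu).
have deg_onto : deg @: [set~ u] = [set~ z].
  apply/eqP; rewrite eqEcard card_in_imset // !cardsC1 card_ord leqnn andbT.
  apply/subsetP=> _ /imsetP[x _ ->]; rewrite !inE -val_eqE /= -lt0n.
  exact: connected_degree_gt0.
(* The default [u] is never reached in range, since [deg_onto] provides a vertex of each such
   degree. *)
exists (fun i => odflt u [pick x | degree e x == i]) => i /andP[i_gt0 i_lt].
case: pickP => [x /eqP //| no_x].
have: Ordinal i_lt \in [set~ z] by rewrite !inE -val_eqE /= -lt0n.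
by rewrite -deg_onto => /imsetP[x _ [/esym/eqP]]; rewrite no_x.
Qed.

Lemma degree_indexed_inj {T : finType} {e : rel T} {v : nat -> T} {i j : nat} :
  degree_indexed e v -> v i = v j ->
  (0 < i < #|T|)%N -> (0 < j < #|T|)%N -> i = j.
Proof. by move=> degv vij /degv <- /degv <-; rewrite vij. Qed.

Lemma leaf_inj {T : finType} {e : rel T} {v : nat -> T} {i : nat} :
  degree_indexed e v -> (i < #|T|)%N -> injective (fun j : 'I_i => v j.+1).
Proof.
move=> degv i_lt j k /(degree_indexed_inj degv) jk; apply: val_inj => /=.
by have := ltn_ord j; have := ltn_ord k; have := jk; lia.
Qed.

Lemma hub_inj {T : finType} {e : rel T} {v : nat -> T} {i : nat} :
  degree_indexed e v -> (i < #|T|)%N ->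
  injective (fun j : 'I_i => v (#|T| - j.+1)%N).
Proof.
move=> degv i_lt j k /(degree_indexed_inj degv) jk; apply: val_inj => /=.
by have := ltn_ord j; have := ltn_ord k; have := jk; lia.
Qed.

Lemma card_leaves {T : finType} {e : rel T} {v : nat -> T} {i : nat} :
  degree_indexed e v -> (i < #|T|)%N -> #|leaves v i| = i.
Proof. by move=> degv i_lt; rewrite card_imset ?card_ord //; apply: leaf_inj degv _. Qed.

Lemma card_hubs {T : finType} {e : rel T} {v : nat -> T} {i : nat} :
  degree_indexed e v -> (i < #|T|)%N -> #|hubs v i| = i.
Proof. by move=> degv i_lt; rewrite card_imset ?card_ord //; apply: hub_inj degv _. Qed.

Lemma mem_leaves {T : finType} {e : rel T} {v : nat -> T} {i j : nat} :
  degree_indexed e v -> (i < #|T|)%N -> (0 < j < #|T|)%N ->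
  (v j \in leaves v i) = (j <= i)%N.
Proof.
move=> degv i_lt j_lt; apply/imsetP/idP=> [[k _ /(degree_indexed_inj degv)]|j_le].
  by have := ltn_ord k; lia.
have j_ok : (j.-1 < i)%N by lia.
by exists (Ordinal j_ok) => //=; congr v; lia.
Qed.

Lemma mem_hubs {T : finType} {e : rel T} {v : nat -> T} {i j : nat} :
  degree_indexed e v -> (i < #|T|)%N -> (0 < j < #|T|)%N ->
  (v j \in hubs v i) = (#|T| <= i + j)%N.
Proof.
move=> degv i_lt j_lt; apply/imsetP/idP=> [[k _ /(degree_indexed_inj degv)]|j_le].
  by have := ltn_ord k; lia.
have j_ok : (#|T| - j.+1 < i)%N by lia.
have jE : j = (#|T| - (#|T| - j.+1).+1)%N by lia.
by exists (Ordinal j_ok) => //; apply: (congr1 v jE).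
Qed.

(** * Adjacency forced by the degrees *)

(** In each claim one inclusion comes from the claims already known, and the prescribed degree turns
    it into an equality by counting. The leaf bound is strict because for [i.+1.*2 = #|T|] the
    vertex [v i.+1] is the last hub. *)
Lemma neighborhoods (T : finType) (e : rel T) (v : nat -> T) (i : nat) :
  simple_graph e -> degree_indexed e v ->
  ((i.+1.*2 <= #|T|)%N ->
     [set y | e (v (#|T| - i.+1)%N) y] = ~: (v (#|T| - i.+1)%N |: leaves v i)) /\
  ((i.+1.*2 < #|T|)%N -> [set y | e (v i.+1) y] = hubs v i.+1).
Proof.
move=> [sym_e irr_e] degv.
elim/ltn_ind: i => i IH.
have hub_i : (i.+1.*2 <= #|T|)%N ->
    [set y | e (v (#|T| - i.+1)%N) y] = ~: (v (#|T| - i.+1)%N |: leaves v i).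
  move=> i_le; apply/eqP; rewrite eqEcard; apply/andP; split.
    apply/subsetP=> y; rewrite !inE => e_y; apply/norP; split.
      by apply: contraTneq e_y => ->; rewrite irr_e.
    apply: contraTN e_y => /imsetP[j _ ->].
    have [_ /(_ _)/setP/(_ (v (#|T| - i.+1)%N))] := IH j (ltn_ord j).
    have j_lt := ltn_ord j.
    rewrite inE sym_e (mem_hubs degv) => [->||]; lia.
  have := cardsC (v (#|T| - i.+1)%N |: leaves v i).
  rewrite cardsU1 (mem_leaves degv) ?(card_leaves degv); try lia.
  have -> : #|[set y | e (v (#|T| - i.+1)%N) y]| = (#|T| - i.+1)%N.
    by apply: degv; lia.
  lia.
split=> // i_lt; apply/esym/eqP; rewrite eqEcard; apply/andP; split.
  apply/subsetP=> _ /imsetP[j _ ->]; rewrite inE sym_e.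
  have j_lt := ltn_ord j.
  (* For [j = i] this is the hub claim just proved, hence the order of the two claims. *)
  have : [set y | e (v (#|T| - j.+1)%N) y] = ~: (v (#|T| - j.+1)%N |: leaves v j).
    have [ji|] := ltnP j i; first by apply: (IH j ji).1; lia.
    by move=> ij; have -> : nat_of_ord j = i by [lia]; apply: hub_i; lia.
  move/setP/(_ (v i.+1)); rewrite !inE (mem_leaves degv); try lia.
  move=> ->; rewrite negb_or -ltnNge ltnS; apply/andP; split; last lia.
  by apply/eqP=> /(degree_indexed_inj degv); lia.
have -> : #|[set y | e (v i.+1) y]| = i.+1 by apply: degv; lia.
by rewrite (card_hubs degv); lia.
Qed.

(** For either parity the two disjoint families have [#|T| - 1] elements together, so one vertex is
    left; its neighborhood is read off from theirs by symmetry of [e]. *)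
Lemma remaining_vertex (T : finType) (e : rel T) (v : nat -> T) :
  (1 < #|T|)%N -> simple_graph e -> degree_indexed e v ->
  exists w, [/\ [set y | e w y] = hubs v #|T|./2,
    w \notin leaves v #|T|.-1./2, w \notin hubs v #|T|./2,
    [disjoint leaves v #|T|.-1./2 & hubs v #|T|./2] &
    [set: T] = w |: (leaves v #|T|.-1./2 :|: hubs v #|T|./2)].
Proof.
move=> T_gt1 simple_e degv; have [sym_e irr_e] := simple_e.
set L := leaves v _; set H := hubs v _.
have disj : [disjoint L & H].
  rewrite disjoints_subset; apply/subsetP=> _ /imsetP[j _ ->]; rewrite inE.
  have j_lt := ltn_ord j.
  rewrite (mem_hubs degv); lia.
have cardL : #|L| = #|T|.-1./2 by apply: card_leaves degv _; lia.
have cardH : #|H| = #|T|./2 by apply: card_hubs degv _; lia.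
have cardLH : #|L :|: H| = #|T|.-1.
  by rewrite cardsU (disjoint_setI0 disj) cards0 cardL cardH; lia.
have: (0 < #|~: (L :|: H)|)%N by have := cardsC (L :|: H); lia.
case/card_gt0P=> w; rewrite !inE negb_or => /andP[wL wH].
have allT : [set: T] = w |: (L :|: H).
  apply/esym/eqP; rewrite eqEcard subsetT cardsU1 cardLH cardsT inE.
  by rewrite (negPf wL) (negPf wH) /=; lia.
exists w; split=> //; apply/setP=> y; rewrite inE.
have := in_setT y.
rewrite allT !inE => /or3P[/eqP->|yL|yH].
- by rewrite irr_e (negPf wH).
- rewrite (disjointFr disj yL) sym_e; case/imsetP: yL => j _ ->.
  have j_lt := ltn_ord j.
  have [_ /(_ _)/setP/(_ w)] := neighborhoods T e v j simple_e degv.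
  rewrite inE => ->; last lia.
  apply: contraNF wH => /imsetP[k _ ->]; have k_lt := ltn_ord k.
  by rewrite (mem_hubs degv); lia.
- rewrite yH sym_e; case/imsetP: yH => j _ yE; rewrite yE.
  have j_lt := ltn_ord j.
  have [/(_ _)/setP/(_ w) + _] := neighborhoods T e v j simple_e degv.
  rewrite !inE => ->; last lia.
  rewrite negb_or; apply/andP; split.
    by apply: contraNneq wH => ->; rewrite (mem_hubs degv); lia.
  apply: contraNN wL => /imsetP[k _ ->]; have k_lt := ltn_ord k.
  by rewrite (mem_leaves degv); lia.
Qed.

(** * Sums over leaves and hubs, and the three-term recurrence *)

Lemma sum_leaves {T : finType} {e : rel T} {v : nat -> T} {R : nmodType}
    (x : T -> R) {i : nat} :
  degree_indexed e v -> (i < #|T|)%N ->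
  \sum_(y in leaves v i) x y = \sum_(j < i) x (v j.+1).
Proof. by move=> degv i_lt; rewrite big_imset //= => j k _ _; apply: leaf_inj degv _ _ _. Qed.

Lemma sum_hubs {T : finType} {e : rel T} {v : nat -> T} {R : nmodType}
    (x : T -> R) {i : nat} :
  degree_indexed e v -> (i < #|T|)%N ->
  \sum_(y in hubs v i) x y = \sum_(j < i) x (v (#|T| - j.+1)%N).
Proof. by move=> degv i_lt; rewrite big_imset //= => j k _ _; apply: hub_inj degv _ _ _. Qed.

(* For [|mu| <= 1/4] the three-term recurrence
   [Z i.+2 = (2 - 1 / mu) * Z i.+1 - Z i] has a coefficient of absolute value
   at least [2], so [|Z i|] is convex; it is stated without division so that
   [mu = 0] is covered. *)
Lemma recurrence_grows (R : realFieldType) (mu : R) (Z : nat -> R) (m : nat) :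
  `|mu| <= 4^-1 -> Z 0%N = 0 ->
  (forall i, (i < m)%N -> mu * (2 * Z i.+1 - Z i - Z i.+2) = Z i.+1) ->
  forall i, (i <= m)%N -> `|Z i| <= `|Z i.+1|.
Proof.
move=> mu_le Z0 rec; elim=> [|i IH] i_lt; first by rewrite Z0 normr0.
have {IH} Zi_le := IH (ltnW i_lt); have eqZ := rec i i_lt.
have [mu0|mu_neq0] := eqVneq mu 0.
  by rewrite -eqZ mu0 mul0r normr0.
have mu_gt0 : 0 < `|mu| by rewrite normr_gt0.
(* Convexity multiplied by [|mu|]: the bound on [mu] gives [1 - 2 * mu >= 2 * |mu|]. *)
have scaled : `|mu| * (2 * `|Z i.+1|) <= `|mu| * (`|Z i| + `|Z i.+2|).
  apply: (@le_trans _ _ `|(1 - 2 * mu) * Z i.+1|).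
    rewrite normrM mulrA ler_wpM2r // ger0_norm.
      by have := ler_norm mu; lra.
    by have := ler_norm mu; lra.
  have -> : (1 - 2 * mu) * Z i.+1 = - (mu * (Z i + Z i.+2)).
    by rewrite mulrBl mul1r -{1}eqZ; ring.
  by rewrite normrN normrM ler_wpM2l // ler_normD.
by move: scaled; rewrite ler_pM2l //; lra.
Qed.

(** Growth gives [|a| * |Z m.+1| = |b| * |Z m| <= |b| * |Z m.+1|], so [Z m.+1 = 0]; monotonicity
    then carries the zero down to every smaller index. *)
Lemma recurrence_eq0 (R : realFieldType) (mu a b : R) (Z : nat -> R) (m : nat) :
  `|mu| <= 4^-1 -> Z 0%N = 0 ->
  (forall i, (i < m)%N -> mu * (2 * Z i.+1 - Z i - Z i.+2) = Z i.+1) ->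
  a * Z m.+1 = b * Z m -> `|b| < `|a| ->
  forall i, (i <= m.+1)%N -> Z i = 0.
Proof.
move=> mu_le Z0 rec last_eq ab.
have grow := recurrence_grows R mu Z m mu_le Z0 rec.
have last0 : Z m.+1 = 0.
  apply/eqP; rewrite -normr_eq0 eq_le normr_ge0 andbT.
  have : `|a| * `|Z m.+1| <= `|b| * `|Z m.+1|.
    by rewrite -normrM last_eq normrM ler_wpM2l ?grow.
  by rewrite -subr_ge0 -mulrBl; apply: contraLR; rewrite -!ltNge => ?; rewrite nmulr_rlt0 // subr_lt0.
suff le_last k : (k <= m.+1)%N -> `|Z (m.+1 - k)%N| <= 0.
  by move=> i i_le; have := le_last (m.+1 - i)%N; rewrite subKn // normr_le0 leq_subr => /(_ isT)/eqP.
elim: k => [|k IH] k_le; first by rewrite subn0 last0 normr0.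
apply: le_trans (IH (ltnW k_le)).
have -> : (m.+1 - k = (m.+1 - k.+1).+1)%N by lia.
by apply: grow; lia.
Qed.

(** The endpoints of [Omega] are the two roots of [(2 * x + 1) ^+ 2 = 2]; this form spares later
    estimates the square root. *)
Lemma Omega_quadratic (R : realType) (lambda : R) :
  (lambda \in Omega R) = ((2 * lambda + 1) ^+ 2 <= 2).
Proof.
rewrite /Omega in_itv /= -[X in _ = (_ <= X)](@sqr_sqrtr R 2) ?ler0n //.
rewrite -[_ ^+ 2 in RHS]real_normK ?num_real // ler_sqr ?nnegrE ?sqrtr_ge0 // ler_norml.
by apply/andP/andP=> -[]; split; lra.
Qed.

(** * No other eigenvalue in [Omega] *)

Lemma eigenfunction_eq0 (R : realType) (T : finType) (e : rel T) (x : T -> R)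
    (lambda : R) :
  (1 < #|T|)%N -> simple_graph e -> connected_graph e -> antiregular e ->
  (forall a, lambda * x a = \sum_(y | e a y) x y) ->
  lambda \in Omega R -> lambda != lambda0 R #|T| ->
  forall a, x a = 0.
Proof.
move=> T_gt1 simple_e conn_e anti_e eig lamO lam_neq.
have [v degv] := degree_indexing T e T_gt1 simple_e.2 conn_e anti_e.
have [w [Nw wL wH disj allT]] := remaining_vertex T e v T_gt1 simple_e degv.
set h := (#|T|./2)%N in Nw wH disj allT.
have [m hE] : exists m, h = m.+1 by exists h.-1; rewrite /h; lia.
(* For even [#|T|] there is one leaf fewer than hubs, and [w], adjacent to all hubs, takes the place
   of the missing last leaf. *)
pose X i := if (i < #|T|.-1./2)%N then x (v i.+1) else x w.
pose Y i := x (v (#|T| - i.+1)%N).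
(* The shift adds the boundary value [Z 0 = 0], so that [diffX] also covers the first hub. *)
pose Z i := if i is j.+1 then X j else 0.
pose S := \sum_y x y.
have nbr a (A : {set T}) : [set y | e a y] = A -> lambda * x a = \sum_(y in A) x y.
  by move=> <-; rewrite eig; apply: eq_bigl => y; rewrite inE.
have sumX i : (i <= #|T|.-1./2)%N -> \sum_(y in leaves v i) x y = \sum_(j < i) X j.
  move=> i_le; rewrite (sum_leaves x degv); last lia.
  by apply: eq_bigr => j _; rewrite /X (leq_trans (ltn_ord j) i_le).
have sumY i : (i <= h)%N -> \sum_(y in hubs v i) x y = \sum_(j < i) Y j.
  by move=> i_le; rewrite (sum_hubs x degv) //; rewrite /h in i_le; lia.
have eqW : lambda * x w = \sum_(j < h) Y j by rewrite -sumY // (nbr _ _ Nw).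
have eqX i : (i < h)%N -> lambda * X i = \sum_(j < i.+1) Y j.
  move=> i_lt; rewrite /X; case: ifP => i_lt'.
    rewrite -sumY //; apply: nbr; apply: (neighborhoods T e v i simple_e degv).2; lia.
  have -> : i.+1 = h by rewrite /h in i_lt *; lia.
  exact: eqW.
have eqY i : (i < h)%N -> (lambda + 1) * Y i = S - \sum_(j < i) X j.
  move=> i_lt; rewrite -sumX; last by rewrite /h in i_lt; lia.
  have /nbr eqd := (neighborhoods T e v i simple_e degv).1 ltac:(rewrite /h in i_lt; lia).
  have hubL : v (#|T| - i.+1)%N \notin leaves v i.
    by rewrite (mem_leaves degv); rewrite /h in i_lt; lia.
  rewrite mulrDl mul1r eqd /S (bigID (mem (leaves v i)) predT) /= [RHS]addrC addrA addNr add0r.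
  rewrite [RHS](bigD1 (v (#|T| - i.+1)%N)) //=.
  rewrite addrC; congr (_ + _); apply: eq_bigl => y.
  by rewrite !inE negb_or andbC.
have sumT : S = x w + (\sum_(j < #|T|.-1./2) X j + \sum_(j < h) Y j).
  have -> : S = \sum_(y in [set: T]) x y by apply: eq_bigl => y; rewrite inE.
  rewrite allT big_setU1 /=; last by rewrite inE negb_or wL wH.
  rewrite -sumX // -sumY // -bigU //=; congr (_ + _); apply: eq_bigl => y.
  by rewrite !inE.
have diffX i : (i < h)%N -> Y i = lambda * (Z i.+1 - Z i).
  case: i => [|i] i_lt.
    by rewrite subr0 eqX // big_ord1.
  by rewrite mulrBr !eqX //; [rewrite big_ord_recr /=; ring | exact: ltnW].
have diffY i : (i.+1 < h)%N -> (lambda + 1) * (Y i - Y i.+1) = Z i.+1.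
  by move=> i_lt; rewrite mulrBr !eqY //; [rewrite big_ord_recr /=; ring | exact: ltnW].
have rec i : (i < m)%N ->
    (lambda ^+ 2 + lambda) * (2 * Z i.+1 - Z i - Z i.+2) = Z i.+1.
  move=> i_lt; rewrite -[RHS]diffY ?hE ?ltnS // !diffX ?hE; try lia.
  by ring.
have lam_sq : (2 * lambda + 1) ^+ 2 <= 2 by rewrite -Omega_quadratic.
(* Since [(2 * lambda + 1) ^+ 2] lies between 0 and 2, [mu] lies between -1/4 and 1/4. *)
have mu_le : `|lambda ^+ 2 + lambda| <= 4^-1.
  have -> : lambda ^+ 2 + lambda = ((2 * lambda + 1) ^+ 2 - 1) / 4 by field.
  by have := sqr_ge0 (2 * lambda + 1); rewrite ler_norml => ?; apply/andP; split; lra.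
(* The last hub equation, with [S] expanded by [sumT] and the hub sum replaced by [lambda * X m],
   relates [Z m.+1] to [Z m] alone. *)
have [a [b [last_eq ab]]] : exists a b : R, a * Z m.+1 = b * Z m /\ `|b| < `|a|.
  have eqm := eqY m ltac:(by rewrite hE); rewrite sumT in eqm.
  have eqXm := eqX m ltac:(by rewrite hE); rewrite -hE in eqXm.
  rewrite -eqXm diffX ?hE // in eqm.
  (* Rational bounds slightly outside [Omega], enough for [|b| < |a|] in both parities. *)
  have lam_lo : -(5/4) < lambda by nra.
  have lam_hi : lambda < 2^-1 by nra.
  case: (boolP (odd #|T|)) lam_neq => T_odd; rewrite /lambda0 ?T_odd ?(negPf T_odd).
    move=> lam_neq0; exists (lambda ^+ 2 - 2), (lambda ^+ 2 + lambda); split.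
      have wE : x w = X m.
        by apply: (mulfI lam_neq0); rewrite eqW eqXm.
      have mE : #|T|.-1./2 = m.+1 by rewrite /h in hE; clear -hE T_odd; lia.
      move: eqm; rewrite mE wE big_ord_recr /= -/(X m) => eqm.
      by move: eqm; set s := \sum_(j < m) _ => eqm; lra.
    apply: le_lt_trans mu_le _; rewrite ler0_norm; nra.
  move=> lam_neq1; exists (lambda - 1), lambda; split; last first.
    by rewrite (ltr0_norm (x := lambda - 1)); [rewrite ltr_norml; apply/andP; split; lra | lra].
  have mE : #|T|.-1./2 = m by rewrite /h in hE; clear -hE T_odd; lia.
  have wE : x w = X m by rewrite /X mE ltnn.
  have lam1 : lambda + 1 != 0 by rewrite addr_eq0.
  move: eqm; rewrite mE wE => eqm.
  have : (lambda + 1) * (lambda * (Z m.+1 - Z m)) = (lambda + 1) * Z m.+1.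
    by rewrite eqm /=; ring.
  by move=> /(mulfI lam1); lra.
have Z0 := recurrence_eq0 R _ a b Z m mu_le erefl rec last_eq ab.
have Y0 i : (i < h)%N -> Y i = 0.
  by move=> i_lt; rewrite diffX // !Z0 ?subrr ?mulr0 // -hE // ltnW.
(* For odd [#|T|] the value at [w] is not among the [Z i]; its own equation gives it, as [lambda] is
   nonzero. *)
have w0 : x w = 0.
  case: (boolP (odd #|T|)) => T_odd.
    move: lam_neq; rewrite /lambda0 T_odd => lam_neq; apply: (mulfI lam_neq).
    by rewrite eqW mulr0 big1 // => j _; apply: Y0.
  have mE : #|T|.-1./2 = m by rewrite /h in hE; clear -hE T_odd; lia.
  by have := Z0 m.+1 (leqnn _); rewrite /= /X mE ltnn.
move=> y; have := in_setT y.
rewrite allT !inE => /or3P[/eqP-> //|/imsetP[j _ ->]|/imsetP[j _ ->]].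
  have j_lt := ltn_ord j; have := Z0 j.+1 ltac:(rewrite /h in hE; clear -hE j_lt; lia).
  by rewrite /= /X j_lt.
exact: Y0.
Qed.

(** * Twin vertices and the eigenvalue [lambda0] *)

(** The eigenvector is the difference of the indicators of [u] and [w]: at every other vertex the
    two contributions cancel. *)
Lemma twins_eigenvalue (R : realType) (n : nat) (e : rel 'I_n) (u w : 'I_n) :
  simple_graph e -> u != w ->
  (forall y, y != u -> y != w -> e u y = e w y) ->
  eigenvalue (adjacency_matrix R e) (- (e u w)%:R).
Proof.
move=> [sym_e irr_e] uw twin; apply/eigenvalueP.
exists (delta_mx 0 u - delta_mx 0 w).
  rewrite mulmxBl -!rowE; apply/rowP=> y; rewrite !mxE eqxx /=.
  have [->|yu] := eqVneq y u.
    by rewrite irr_e (negPf uw) (sym_e w); case: (e u w); rewrite /= ?mulr0n ?mulr1n; ring.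
  have [->|yw] := eqVneq y w.
    by rewrite irr_e; case: (e u w); rewrite /= ?mulr0n ?mulr1n; ring.
  by rewrite twin // !subrr mulr0.
apply/eqP=> /rowP/(_ u); rewrite !mxE !eqxx (negPf uw) /= => /eqP.
by rewrite subr0 oner_eq0.
Qed.

(** The twin of [w] is the last leaf (odd case, not adjacent to [w]) or the last hub (even case,
    adjacent to [w]), which misses only itself and all leaves. *)
Lemma lambda0_twins (R : realType) (T : finType) (e : rel T) :
  (1 < #|T|)%N -> simple_graph e -> connected_graph e -> antiregular e ->
  exists u w, [/\ u != w, forall y, y != u -> y != w -> e u y = e w y &
    lambda0 R #|T| = - (e u w)%:R].
Proof.
move=> T_gt1 simple_e conn_e anti_e; have [sym_e irr_e] := simple_e.
have [v degv] := degree_indexing T e T_gt1 irr_e conn_e anti_e.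
have [w [/setP Nw wL wH disj allT]] := remaining_vertex T e v T_gt1 simple_e degv.
have [m hE] : exists m, (#|T|./2 = m.+1)%N by exists (#|T|./2).-1; lia.
rewrite hE in Nw wH disj allT; rewrite /lambda0; case: ifP => T_odd.
  have mE : #|T|.-1./2 = m.+1 by lia.
  have := (neighborhoods T e v m simple_e degv).2 ltac:(lia).
  move=> /setP Nu.
  exists (v m.+1), w; split.
  - by apply: contraNneq wL => <-; rewrite (mem_leaves degv); lia.
  - by move=> y _ _; have := Nu y; have := Nw y; rewrite !inE => -> ->.
  - by have := Nu w; rewrite inE (negPf wH) => ->; rewrite oppr0.
have mE : #|T|.-1./2 = m by lia.
have := (neighborhoods T e v m simple_e degv).1 ltac:(lia).
move=> /setP Nu; exists (v (#|T| - m.+1)%N), w; split.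
- by apply: contraNneq wH => <-; rewrite (mem_hubs degv); lia.
- move=> y yu yw; have := Nu y; have := Nw y; rewrite !inE => -> ->.
  have := in_setT y.
  rewrite allT !inE (negPf yu) (negPf yw) mE /=.
  case: (boolP (y \in leaves v m)) => [yL _|_ /= -> //].
  by rewrite -{1}mE in yL; rewrite (disjointFr disj yL).
- have := Nw (v (#|T| - m.+1)%N); rewrite !inE (mem_hubs degv); try lia.
  by rewrite sym_e => ->; have -> : (#|T| <= m.+1 + (#|T| - m.+1))%N by lia.
Qed.

Theorem theorem2p1 (R : realType) (n : nat) (e : rel 'I_n)
  (hn : (2 <= n)%N) (he : is_connected_antiregular e) :
  forall lambda : R,
    (eigenvalue (adjacency_matrix R e) lambda /\ lambda \in Omega R)
    <-> lambda = lambda0 R n.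
Proof.
case: he => simple_e conn_e anti_e lambda.
have T_gt1 : (1 < #|'I_n|)%N by rewrite card_ord.
split=> [[/eigenvalueP[x x_eig x_neq0] lamO]|->].
  apply/eqP; apply: contraNT x_neq0 => lam_neq; apply/eqP/rowP=> i; rewrite mxE.
  apply: (eigenfunction_eq0 R _ e (x 0) lambda) => //; last by rewrite card_ord.
  (* Eigenvectors are rows here, so symmetry of [e] is needed to sum over the neighbors of [a]. *)
  move=> a; have /rowP/(_ a) := x_eig; rewrite !mxE => <-.
  rewrite [RHS]big_mkcond /=; apply: eq_bigr => y _.
  by rewrite mxE (simple_e.1 y); case: ifP; rewrite ?mulr1 ?mulr0.
split; last first.
  by rewrite Omega_quadratic /lambda0; case: ifP => _; lra.
have [u [w [uw twin]]] := lambda0_twins R _ e T_gt1 simple_e conn_e anti_e.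
by rewrite card_ord => ->; apply: twins_eigenvalue.
Qed.
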